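(* Let $R$ be a ring. (a) If every nonzero right ideal of $R$ contains a right regular element, then $R$ is right weakly uniserial. (b) If $R$ is a domain, then $R$ is a right and left weakly uniserial ring. (c) If $R$ is either a principal right ideal domain or a right hereditary local ring, then every projective right $R$-module is weakly uniserial.
   Context: Rings are associative with identity, not necessarily commutative, and modules are unitary. A module $M$ is called weakly uniserial if for any two submodules $N$ and $K$ of $M$ there exists an injective module homomorphism $N\to K$ or an injective module homomorphism $K\to N$. A ring $R$ is right (left) weakly uniserial if it is weakly uniserial as a right (left) module over itself. An element $a\in R$ is right regular if its right annihilator $\{r\in R: ar=0\}$ is $0$. $R$ is right hereditary if every right ideal of $R$ is projective as a right $R$-module. $R$ is local if it has a unique maximal right ideal. *)

(* Defs.v *)
From HB Require Import structures.
From mathcomp Require Import all_boot all_algebra.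
From mathcomp Require Import boolp.
Set Implicit Arguments.
Unset Strict Implicit.
Unset Printing Implicit Defensive.
Import GRing.Theory.
Local Open Scope ring_scope.

(* Rings are pzRingType, so the zero ring is allowed.  A left R-module is an
   lmodType R and a right R-module is an lmodType R^c, where R^c is the opposite
   ring: a right action m * r is written r *: m.

   Submodules are GRing's boolean predicates closed under the module operations.
   In the presence of excluded middle (boolp) every Prop-valued predicate is
   equivalent to a boolean one, so all submodules are covered.  Likewise every
   type carries the choice structure that is part of lmodType. *)

Definition submod (R : pzRingType) (M : lmodType R) (N : submodClosed M) : Type :=
  {x : M | x \in N}.

Section SubmodInstances.
Variables (R : pzRingType) (M : lmodType R) (N : submodClosed M).
HB.instance Definition _ := SubChoice.on (submod N).
HB.instance Definition _ := [SubChoice_isSubLmodule of submod N by <:].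
End SubmodInstances.

Definition weakly_uniserial (R : pzRingType) (M : lmodType R) : Prop :=
  forall N K : submodClosed M,
    (exists f : {linear submod N -> submod K}, injective f) \/
    (exists f : {linear submod K -> submod N}, injective f).

Definition projective (R : pzRingType) (P : lmodType R) : Prop :=
  forall (A B : lmodType R) (g : {linear A -> B}) (f : {linear P -> B}),
    (forall b : B, exists a : A, g a = b) ->
    exists h : {linear P -> A}, forall x : P, g (h x) = f x.

(* The right regular module R_R: here r *: x is x * r. *)
Definition right_regular_module (R : pzRingType) : lmodType R^c := (R^c)^o.

Definition left_regular_module (R : pzRingType) : lmodType R := R^o.

Definition right_ideal (R : pzRingType) : Type :=
  submodClosed (right_regular_module R).

Definition right_weakly_uniserial (R : pzRingType) : Prop :=
  weakly_uniserial (right_regular_module R).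

Definition left_weakly_uniserial (R : pzRingType) : Prop :=
  weakly_uniserial (left_regular_module R).

Definition right_regular (R : pzRingType) (a : R) : Prop :=
  forall r : R, a * r = 0 -> r = 0.

Definition domain (R : pzRingType) : Prop :=
  (1 : R) <> 0 /\ forall x y : R, x * y = 0 -> x = 0 \/ y = 0.

Definition principal (R : pzRingType) (I : right_ideal R) : Prop :=
  exists a : R, forall x : R, x \in I <-> exists r : R, x = a * r.

Definition principal_right_ideal_domain (R : pzRingType) : Prop :=
  domain R /\ forall I : right_ideal R, principal I.

Definition right_hereditary (R : pzRingType) : Prop :=
  forall I : right_ideal R, projective (submod I).

Definition maximal_right_ideal (R : pzRingType) (I : right_ideal R) : Prop :=
  (exists x : R, x \notin I) /\
  forall J : right_ideal R, {subset I <= J} ->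
    J =i I \/ forall x : R, x \in J.

(* Uniqueness is up to equality of membership. *)
Definition local (R : pzRingType) : Prop :=
  exists I : right_ideal R, maximal_right_ideal I /\
    forall J : right_ideal R, maximal_right_ideal J -> J =i I.

(* Main.v *)
(* (a) and (b): if a nonzero right ideal K contains a right regular a, every
   right ideal embeds into K by x |-> a x.

   (c): in a local right hereditary ring, a R is projective for a <> 0, so the
   right annihilator of a is (1 - e) R with e a nonzero idempotent; locality
   forces e = 1, so the ring is a domain.  It remains to treat a projective
   module P over a domain.  P embeds into a free module; well-order the basis
   and let X(N) be the set of least support indices of the nonzero elements of
   a submodule N.  Projecting onto the coordinates in X(N) is injective on N,
   since it keeps the least term.  Given an injection s : X(N) -> X(K), choose
   k_y in K with least index y for y in X(K); then
   n |-> sum over x in X(N) of (x-th coordinate of n) k_(s x)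
   embeds N into K.  Cardinals being comparable, such an s exists in one of the
   two directions. *)
Require Import Defs.
From HB Require Import structures.
From mathcomp Require Import all_boot all_algebra.
From mathcomp Require Import boolp classical_sets functions cardinality fsbigop.
From mathcomp Require Import wochoice.
Set Implicit Arguments.
Unset Strict Implicit.
Unset Printing Implicit Defensive.
Import GRing.Theory.
Local Open Scope ring_scope.

(** * Comparability of cardinals *)

(** Zorn's lemma on graphs of partial injections from [A] to [B]: a maximal graph is defined on all
    of [A] or hits all of [B], since otherwise an unmatched pair could be added. *)
Lemma card_le_total (T U : Type) (A : set T) (B : set U) :
  (A #<= B)%card || (B #<= A)%card.
Proof.
pose P (F : set (T * U)) := [/\ forall p, F p -> A p.1 /\ B p.2,
  forall p q, F p -> F q -> p.1 = q.1 -> p = q &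
  forall p q, F p -> F q -> p.2 = q.2 -> p = q].
have PU (C : set (set (T * U))) : (C `<=` P)%classic -> total_on C subset ->
    P (\bigcup_(X in C) X)%classic.
  move=> CP Ctot.
  have two p q : (\bigcup_(X in C) X)%classic p ->
      (\bigcup_(X in C) X)%classic q -> exists2 X, C X & X p /\ X q.
    case=> X CX Xp [Y CY Yq]; case: (Ctot _ _ CX CY) => sub.
      by exists Y => //; split=> //; apply: sub.
    by exists X => //; split=> //; apply: sub.
  split=> [p [X /CP[PX _ _] /PX]//|p q|p q] Cp Cq.
    by have [X /CP[_ inj _] [Xp Xq]] := two _ _ Cp Cq; apply: inj.
  by have [X /CP[_ _ inj] [Xp Xq]] := two _ _ Cp Cq; apply: inj.
have [F [[FAB F1 F2] Fmax]] := Zorn_bigcup PU.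
have [totA|/existsNP[a /not_implyP[Aa Fa]]] :=
    pselect (forall a, A a -> exists b, F (a, b)).
  (* Choosing [f] on all of [T] takes a default value [b0] in [U], whence the separate case of empty
     [A]. *)
  apply/orP; left; have [->|/set0P[a0 Aa0]] := eqVneq A set0; first exact: card_ge0.
  have [b0 _] := totA _ Aa0.
  have /choice[f Ff] a : exists b, A a -> F (a, b).
    by have [/totA[b Fb]|nAa] := pselect (A a); [exists b | exists b0].
  have /injfunPex[g] : exists2 f : T -> U, set_fun A B f & set_inj A f.
    exists f => [a Aa|a a' /set_mem Aa /set_mem Aa' eq_f].
      by have [] := FAB _ (Ff _ Aa).
    by have [] := F2 _ _ (Ff _ Aa) (Ff _ Aa') eq_f.
  exact: inj_card_le.
have [totB|/existsNP[b /not_implyP[Bb Fb]]] :=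
    pselect (forall b, B b -> exists a, F (a, b)).
  apply/orP; right.
  have /choice[f Ff] b : exists a, B b -> F (a, b).
    by have [/totB[a' Fa']|nBb] := pselect (B b); [exists a' | exists a].
  have /injfunPex[g] : exists2 f : U -> T, set_fun B A f & set_inj B f.
    exists f => [b Bb|b b' /set_mem Bb /set_mem Bb' eq_f].
      by have [] := FAB _ (Ff _ Bb).
    by have [] := F1 _ _ (Ff _ Bb) (Ff _ Bb') eq_f.
  exact: inj_card_le.
exfalso; apply: (Fmax (F `|` [set (a, b)])%classic).
  split; first by left.
  by move=> /(_ (a, b)) sub; apply: Fa; exists b; apply: sub; right.
split=> [p [/FAB//|->//]|p q [Fp|->] [Fq|->] //= pq|p q [Fp|->] [Fq|->] //= pq].
- exact: F1.
- by case: Fa; exists p.2; rewrite -pq -surjective_pairing.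
- by case: Fa; exists q.2; rewrite pq -surjective_pairing.
- exact: F2.
- by case: Fb; exists p.1; rewrite -pq -surjective_pairing.
- by case: Fb; exists q.1; rewrite pq -surjective_pairing.
Qed.

(** * Submodules and embeddings between them *)

Lemma exists_submodClosed (S : pzRingType) (M : lmodType S) (A : set M) :
  A 0 -> (forall r x y, A x -> A y -> A (r *: x + y)) ->
  exists N : submodClosed M, forall x, x \in N <-> A x.
Proof.
move=> A0 AZ.
pose N0 : M -> bool := fun x => `[< A x >].
have N0_closed : GRing.subsemimod_closed N0.
  apply: GRing.submod_closed_semi; split; first exact/asboolP.
  by move=> r x y /asboolP Ax /asboolP Ay; apply/asboolP/AZ.
pose N : submodClosed M :=
  HB.pack N0 (GRing.isSubmodClosed.Build S M N0 N0_closed).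
by exists N => x; split=> /asboolP.
Qed.

Lemma submod_embedding (S : pzRingType) (M M' : lmodType S)
    (f : {linear M -> M'}) (N : submodClosed M) (K : submodClosed M') :
  (forall x, x \in N -> f x \in K) ->
  (forall x, x \in N -> f x = 0 -> x = 0) ->
  exists g : {linear submod N -> submod K}, injective g.
Proof.
move=> fNK f0.
pose g (u : submod N) : submod K := exist _ (f (val u)) (fNK _ (valP u)).
have g_lin : linear g.
  by move=> r u v; apply: val_inj; rewrite /= linearP.
pose gl : {linear submod N -> submod K} :=
  HB.pack g (GRing.isLinear.Build S (submod N) (submod K) *:%R g g_lin).
exists gl; apply: raddf_inj => u /(congr1 val) /= fu.
by apply/val_inj/f0 => //; apply: valP.
Qed.

(** A general [S] serves both sides: over [R^c] the map [r |-> r *: a] is left multiplication by [a]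
    in [R]. *)
Lemma regular_weakly_uniserial (S : pzRingType) :
  (forall I : submodClosed S^o, (exists2 x, x \in I & x <> 0) ->
    exists2 a : S^o, a \in I & forall r : S, r *: a = 0 -> r = 0) ->
  weakly_uniserial S^o.
Proof.
move=> reg N K.
have emb (I J : submodClosed S^o) : (exists2 x, x \in I & x <> 0) ->
    exists f : {linear submod J -> submod I}, injective f.
  move=> /reg[a Ia a_reg].
  have a_lin : linear (fun r : S^o => r *: a).
    by move=> r x y; rewrite scalerDl -[X in _ = X + _]/((r * (x * a))) mulrA.
  pose f : {linear S^o -> S^o} :=
    HB.pack (fun r : S^o => r *: a) (GRing.isLinear.Build S S^o S^o *:%R _ a_lin).
  apply: (@submod_embedding _ _ _ f J I) => x xJ; first exact: rpredZ.
  exact: a_reg.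
have [/emb|K0] := pselect (exists2 x, x \in K & x <> 0); first by left.
right; apply: (@submod_embedding _ S^o S^o idfun K N) => x xK.
  suff -> : x = 0 by rewrite rpred0.
  by apply: contrapT => x0; apply: K0; exists x.
done.
Qed.

(** * Free modules as finitely supported functions *)

Definition finsupp_pred (X : choiceType) (S : pzRingType) : pred (X -> S^o) :=
  fun f => `[< finite_set [set x | f x <> 0]%classic >].

Section FreeModule.
Variables (X : choiceType) (S : pzRingType).

Lemma finsupp_pred_closed : GRing.subsemimod_closed (@finsupp_pred X S).
Proof.
apply: GRing.submod_closed_semi; split=> [|r f g /asboolP fin_f /asboolP fin_g].
  apply/asboolP; rewrite (_ : [set _ | _]%classic = set0) //.
  by rewrite -subset0 => x; apply.
have fin_fg := conj fin_f fin_g; rewrite -finite_setU in fin_fg.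
apply/asboolP/(sub_finite_set _ fin_fg) => x /= fgx.
apply: contrapT => /not_orP[/contrapT fx /contrapT gx]; apply: fgx.
by rewrite -[LHS]/(r *: f x + g x) fx gx scaler0 addr0.
Qed.

Definition finsupp_submod : submodClosed (X -> S^o) :=
  HB.pack (@finsupp_pred X S)
    (GRing.isSubmodClosed.Build S (X -> S^o) (@finsupp_pred X S)
      finsupp_pred_closed).

Definition free_module : lmodType S := submod finsupp_submod.

Definition supp (f : free_module) : set X := [set x | val f x <> 0]%classic.

Lemma finite_supp (f : free_module) : finite_set (supp f).
Proof. exact/asboolP/(valP f). Qed.

Lemma supp_eq0 (f : free_module) : supp f = set0 -> f = 0.
Proof.
move=> f0; apply/val_inj/funext => x; apply: contrapT => fx.
by have : supp f x by []; rewrite f0.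
Qed.

Variables (M : lmodType S) (v : X -> M).

(** The linear map given by the universal property of the free module; only finitely many terms of
    the sum are nonzero. *)
Definition lincomb (f : free_module) : M := \sum_(x \in setT) (val f x : S) *: v x.

(** As [s] may exceed the support, several elements can be summed over one common list. *)
Lemma lincombE (s : seq X) (f : free_module) :
  uniq s -> (supp f `<=` [set` s])%classic ->
  lincomb f = \sum_(x <- s) (val f x : S) *: v x.
Proof.
move=> s_uniq sub; rewrite /lincomb [RHS]fsbig_seq //; apply/esym/fsbig_widen => //.
move=> x [_ /= xs]; apply: contrapT => fx; apply: xs; apply: sub => fx0.
by apply: fx; rewrite fx0 scale0r.
Qed.

Lemma lincomb_linear : linear lincomb.
Proof.
move=> r f g; have /finite_seqP[s0 s0E] : finite_set (supp f `|` supp g)%classic.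
  by rewrite finite_setU; split; apply: finite_supp.
pose s := undup s0; have s_uniq : uniq s by apply: undup_uniq.
have sP x : (supp f `|` supp g)%classic x -> x \in s.
  by rewrite s0E mem_undup.
rewrite !(@lincombE s) //.
- rewrite scaler_sumr -big_split /=; apply: eq_bigr => x _.
  by rewrite scalerA -scalerDl.
- by move=> x gx; apply: sP; right.
- by move=> x fx; apply: sP; left.
- move=> x fgx; apply: sP; apply: contrapT => /not_orP[/contrapT fx /contrapT gx].
  by apply: fgx; rewrite -[LHS]/((r : S) * val f x + val g x) fx gx mulr0 addr0.
Qed.

HB.instance Definition _ :=
  GRing.isLinear.Build S free_module M *:%R lincomb lincomb_linear.

Lemma basis_fun_finsupp (y : X) :
  (fun x => if x == y then 1 else 0 : S^o) \in finsupp_submod.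
Proof.
apply/asboolP/(sub_finite_set _ (finite_set1 y)) => x /=.
by case: eqP.
Qed.

Definition basis_vector (y : X) : free_module :=
  exist (fun f : X -> S^o => f \in finsupp_submod) _ (basis_fun_finsupp y).

Lemma lincomb_basis_vector (y : X) : lincomb (basis_vector y) = v y.
Proof.
rewrite (@lincombE [:: y]) // => [|x].
  by rewrite big_seq1 /= eqxx scale1r.
by rewrite /supp /= inE; case: eqP.
Qed.

End FreeModule.

(** * Projective modules over a domain *)

(** [P] is a quotient of the free module on its own elements; projectivity lifts the identity to a
    section, which is injective. *)
Lemma projective_embeds_free (S : pzRingType) (P : lmodType S) :
  projective P -> exists c : {linear P -> free_module P S}, injective c.
Proof.
move=> projP.
have surj (x : P) : exists f, lincomb idfun f = x.
  by exists (basis_vector S x); rewrite lincomb_basis_vector.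
have [c cK] := projP _ _ (@lincomb P S P idfun) idfun surj.
by exists c; apply: can_inj cK.
Qed.

Lemma exists_minimizing_order (X : eqType) : exists R : rel X,
  antisymmetric R /\ forall A : set X, (A !=set0)%classic ->
    exists2 x, A x & forall y, A y -> R x y.
Proof.
have [R wo_R] := well_ordering_principle X; exists R; split=> [x y|A [a Aa]].
  apply: (@wo_chain_antisymmetric _ _ predT) => // A _; exact: wo_R.
have [|x [[/asboolP Ax minx] _]] := wo_R (fun x => `[< A x >]).
  by exists a; apply/asboolP.
by exists x => // y Ay; apply/minx/asboolP.
Qed.

Section LeadingIndices.
Variables (X : choiceType) (S : pzRingType) (leX : rel X) (P : lmodType S).
Variable c : {linear P -> free_module X S}.

(** A relation rather than a function, since zero has no least support index. *)
Definition lead (f : free_module X S) (x : X) :=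
  supp f x /\ forall y, supp f y -> leX x y.

Definition lead_indices (N : submodClosed P) : set X :=
  [set x | exists2 n, n \in N & lead (c n) x]%classic.

(** The injection [s] need not be monotone. For nonzero [n] in [N], the index [x] is therefore
    chosen to minimise [s x], not [x], among the support indices of [c n] in [lead_indices N]; the
    coordinate of the image at [s x] then has exactly one nonzero term. *)
Lemma embedding_of_lead_indices (N K : submodClosed P) (s : X -> X) :
  domain S -> injective c -> antisymmetric leX ->
  (forall A : set X, (A !=set0)%classic ->
    exists2 x, A x & forall y, A y -> leX x y) ->
  set_fun (lead_indices N) (lead_indices K) s -> set_inj (lead_indices N) s ->
  exists f : {linear submod N -> submod K}, injective f.
Proof.
move=> [_ Sdom] c_inj leX_anti leX_min sNK s_inj.
have /choice[k kP] x : exists k, k \in K /\ (lead_indices N x -> lead (c k) (s x)).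
  have [/sNK[k kK leadk]|nNx] := pselect (lead_indices N x); first by exists k.
  by exists 0; rewrite rpred0.
(* The value 0 outside [lead_indices N] builds the projection onto these coordinates into [phi]. *)
pose v x := if x \in lead_indices N then k x else 0.
pose phi : {linear P -> P} := lincomb (v : X -> P) \o c.
have phiE n : exists2 r : seq X, uniq r & (supp (c n) `<=` [set` r])%classic /\
    phi n = \sum_(x <- r) (val (c n) x : S) *: v x.
  have /finite_seqP[r0 r0E] := finite_supp (c n); exists (undup r0).
    exact: undup_uniq.
  have sub : (supp (c n) `<=` [set` undup r0])%classic.
    by rewrite r0E => x; rewrite /= mem_undup.
  by split=> //; apply: lincombE => //; apply: undup_uniq.
apply: (@submod_embedding _ P P phi N K) => n nN.
  have [r _ [_ ->]] := phiE n; apply: rpred_sum => x _; apply: rpredZ.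
  by rewrite /v; case: ifP => _; [case: (kP x) | exact: rpred0].
move=> phin0; apply: contrapT => n0.
pose A := (supp (c n) `&` lead_indices N)%classic.
(* The least support index of [c n] belongs to [A]. *)
have A0 : (s @` A !=set0)%classic.
  have [x [cnx xmin]] : exists x, lead (c n) x.
    have /leX_min[x cnx xmin] : (supp (c n) !=set0)%classic.
      apply/set0P/eqP => /supp_eq0 cn0; apply: n0; apply: c_inj.
      by rewrite cn0 linear0.
    by exists x.
  by exists (s x), x => //; split=> //; exists n.
have [_ [x [cnx Nx] <-] xmin] := leX_min _ A0.
have [r r_uniq [sub phin]] := phiE n.
pose coord (f : free_module X S) : S := val f (s x).
have : coord (c (phi n)) = 0 by rewrite phin0 linear0.
rewrite phin linear_sum (big_morph coord (id1 := 0) (op1 := +%R)) // /coord.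
rewrite (bigD1_seq x) //=; last exact: sub.
rewrite big1 => [|y y_neq].
  (* The term at [x] is a product of two nonzero elements of a domain. *)
  rewrite addr0 linearZ /v mem_set // => /Sdom[//|].
  by have [_ /(_ Nx)[]] := kP x.
rewrite /v; case: ifPn => [/set_mem Ny|_]; last by rewrite scaler0 linear0.
rewrite linearZ; apply: contrapT => nz; move/eqP: y_neq; apply.
apply: s_inj; rewrite ?mem_set //.
(* A nonzero term at [y] gives [s y <= s x], as [s y] is least in the support of [c (k y)], and
   [s x <= s y] by the choice of [x]. *)
have [_ /(_ Ny)[_ lead_sy]] := kP y.
apply: leX_anti; rewrite lead_sy /=.
  apply: xmin; exists y => //; split=> // cny.
  by apply: nz; rewrite -[LHS]/((val (c n) y : S) * _) cny mul0r.
move=> ksx; apply: nz.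
by rewrite -[LHS]/((val (c n) y : S) * val (c (k y)) (s x)) ksx mulr0.
Qed.

End LeadingIndices.

Lemma projective_weakly_uniserial (S : pzRingType) (P : lmodType S) :
  domain S -> projective P -> weakly_uniserial P.
Proof.
move=> domS /projective_embeds_free[c c_inj] N K.
have [leP [leP_anti leP_min]] := exists_minimizing_order P.
pose X := lead_indices leP c.
(* The base point 0 is needed to turn an inequality of cardinals into a function on all of [P]. *)
pose pP : pointedType := HB.pack (P : Type) (Choice.on P) (isPointed.Build P 0).
have [/(@pcard_leP _ pP)|/(@pcard_leP _ pP)] := orP (card_le_total (X N) (X K)).
  move=> /injfunPex[s sNK s_inj]; left.
  exact: embedding_of_lead_indices sNK s_inj.
move=> /injfunPex[s sNK s_inj]; right.
exact: embedding_of_lead_indices sNK s_inj.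
Qed.

Lemma domain_converse (R : pzRingType) : domain R -> domain R^c.
Proof. by case=> R1 Rdom; split=> // x y /Rdom[]; [right | left]. Qed.

Lemma domain_regular_weakly_uniserial (S : pzRingType) :
  domain S -> weakly_uniserial S^o.
Proof.
move=> [_ Sdom]; apply: regular_weakly_uniserial => I [x xI x0].
by exists x => // r /Sdom[].
Qed.

(** * Maximal right ideals and local hereditary rings *)

Section RightIdeals.
Variable R : pzRingType.
Local Notation RR := (right_regular_module R).

Lemma principal_right_ideal (a : R) :
  exists I : right_ideal R, forall x : R, x \in I <-> exists r, x = a * r.
Proof.
apply: (@exists_submodClosed _ RR [set x : R | exists r, x = a * r]%classic).
  by exists 0; rewrite mulr0.
move=> r _ _ [x ->] [y ->]; exists (x * r + y).
by rewrite mulrDr mulrA.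
Qed.

(** Zorn's lemma applies because properness means missing 1, which passes to unions of chains. *)
Lemma maximal_right_ideal_containing (I : right_ideal R) :
  (1 : R) \notin I ->
  exists2 J : right_ideal R, maximal_right_ideal J & {subset I <= J}.
Proof.
move=> I1.
(* P speaks of I `|` A rather than A so that it also holds for the union set0
   of the empty chain. *)
pose P (A : set R) := exists J : right_ideal R,
  [/\ (1 : R) \notin J, {subset I <= J} & forall x, x \in J <-> x \in I \/ A x].
have P0 : P set0 by exists I; split=> // x; split=> [|[]]; first by left.
have PU (C : set (set R)) : (C `<=` P)%classic -> total_on C subset ->
    P (\bigcup_(A in C) A)%classic.
  move=> CP Ctot; pose U (x : R) := x \in I \/ (\bigcup_(A in C) A)%classic x.
  (* Two elements of the union lie in a single ideal: the larger of two chain members, or [I]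
     itself, encoded by [set0]. *)
  have two x y : U x -> U y -> exists A,
      [/\ P A, (forall z, z \in I \/ A z -> U z), x \in I \/ A x & y \in I \/ A y].
    have one A z : C A -> z \in I \/ A z -> U z.
      by move=> CA [|Az]; [left | right; exists A].
    move=> [xI|[A CA Ax]] [yI|[B CB By]].
    - by exists set0; split=> //; [move=> z [|[]]; left | left | left].
    - by exists B; split=> //; [apply: CP | move=> z; apply: one | left | right].
    - by exists A; split=> //; [apply: CP | move=> z; apply: one | right | left].
    - have [AB|BA] := Ctot _ _ CA CB.
        by exists B; split=> //; [apply: CP | move=> z; apply: one
          | right; apply: AB | right].
      by exists A; split=> //; [apply: CP | move=> z; apply: one
        | right | right; apply: BA].
  have [||J JU] := @exists_submodClosed _ RR U; first by left; apply: rpred0.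
    move=> r x y Ux Uy; have [A [[J [_ _ JA]] AU Ax Ay]] := two _ _ Ux Uy.
    by apply/AU/JA/rpredD; [apply: rpredZ|]; apply/JA.
  exists J; split=> // [|x xI]; last by apply/JU; left.
  apply/negP => /JU U1; have [A [[J' [J'1 _ J'A]] _ A1 _]] := two _ _ U1 U1.
  by move/negP: J'1; apply; apply/J'A.
have [A [[J [J1 IJ JA]] Amax]] := Zorn_bigcup PU.
exists J => //; split=> [|K JK]; first by exists 1.
have [K1|K1] := boolP ((1 : R) \in K).
  right=> x; suff -> : x = (x : R^c) *: (1 : RR) by apply: rpredZ.
  by rewrite -[RHS]/(1 * x) mul1r.
left; have AK : (A `<=` [set` K])%classic by move=> x Ax; apply/JK/JA; right.
have PK : P [set` K]%classic.
  by exists K; split=> // [x /IJ/JK//|x]; split=> [|[/IJ/JK|]//]; right.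
have KA : ([set` K] `<=` A)%classic.
  by apply: contrapT => KA; exact: (Amax _ (conj AK KA) PK).
by move=> x; apply/idP/idP => [xK|/JK//]; apply/JA; right; apply: KA.
Qed.

(** An element without right inverse lies in the maximal right ideal. If [e] is neither 0 nor 1,
    this holds for both [e] and [1 - e], hence for their sum 1, which is absurd. *)
Lemma local_idempotent (e : R) : local R -> e * e = e -> e = 0 \/ e = 1.
Proof.
move=> [I [[[x0 x0I] _] Iuniq]] ee.
have sub_I (a : R) : (forall r, a * r <> 1) -> a \in I.
  move=> a1; have [A AE] := principal_right_ideal a.
  have [|J Jmax AJ] := @maximal_right_ideal_containing A.
    by apply/negP => /AE[r /esym/a1].
  by rewrite -(Iuniq _ Jmax); apply/AJ/AE; exists 1; rewrite mulr1.
have [->|e1] := eqVneq e 1; [by right | left; apply: contrapT => e0].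
have eI : e \in I.
  apply: sub_I => r er; move/eqP: e1; apply.
  by rewrite -[LHS]mulr1 -er mulrA ee.
have e'I : 1 - e \in I.
  apply: sub_I => r er; apply: e0.
  by rewrite -[LHS]mulr1 -er mulrA mulrBr mulr1 ee subrr mul0r.
move/negP: x0I; apply; have -> : x0 = (x0 : R^c) *: ((e : RR) + (1 - e : R)).
  by rewrite addrC subrK -[RHS]/(1 * x0) mul1r.
by apply: rpredZ; apply: rpredD.
Qed.

Lemma hereditary_local_domain : right_hereditary R -> local R -> domain R.
Proof.
move=> hered loc; split=> [R1|a b ab].
  (* The zero ring has no proper right ideal. *)
  have [I [[[x xI] _] _]] := loc; move/negP: xI; apply.
  by rewrite -[x]mulr1 R1 mulr0; apply: rpred0.
have [->|a0] := eqVneq a 0; [by left | right].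
have [I IE] := principal_right_ideal a.
have aI r : a * r \in I by apply/IE; exists r.
pose g0 (r : RR) : submod I := exist (fun x : RR => x \in I) (a * (r : R)) (aI r).
have g_lin : linear g0.
  by move=> r x y; apply: val_inj; rewrite /= mulrDr mulrA.
pose g : {linear RR -> submod I} :=
  HB.pack g0 (GRing.isLinear.Build _ RR (submod I) *:%R g0 g_lin).
have g_surj (y : submod I) : exists r, g r = y.
  have /IE[r yE] := valP y; exists r; exact: val_inj.
have [h hK] := hered I _ _ g idfun g_surj.
(* Since [h] splits [r |-> a * r], the element [e = h a] satisfies [a * e = a] and
   [h (a * r) = e * r]; taking [r = e] shows that it is idempotent. *)
pose e : R := h (g 1).
have gZ (r : R) : g r = (r : R^c) *: g 1.
  by rewrite -linearZ; congr (g _); rewrite -[RHS]/(1 * r) mul1r.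
have ge : g e = g 1 by apply: hK.
have hg (r : R) : h (g r) = e * r by rewrite gZ linearZ.
have [|e0|e1] := local_idempotent loc (e := e); first by rewrite -hg ge.
  move/eqP: a0; case; have /(congr1 val) /= := ge.
  by rewrite e0 mulr0 mulr1.
(* With [e = 1] the section gives [b = h (a * b) = h 0 = 0]. *)
rewrite -[b]mul1r -e1 -hg (_ : g b = 0) ?linear0 //.
by apply: val_inj.
Qed.

End RightIdeals.

Theorem proposition2p12 (R : pzRingType) :
  ((forall I : right_ideal R,
      (exists x : R, x \in I /\ x <> 0) ->
      exists a : R, a \in I /\ right_regular a) ->
    right_weakly_uniserial R)
  /\ (domain R -> right_weakly_uniserial R /\ left_weakly_uniserial R)
  /\ (principal_right_ideal_domain R \/ (right_hereditary R /\ local R) ->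
      forall P : lmodType R^c, projective P -> weakly_uniserial P).
Proof.
split; [move=> reg | split=> [domR|hypR P]].
- apply: regular_weakly_uniserial => I [x xI x0].
  by have [|a [aI a_reg]] := reg I; [exists x | exists a].
- split; last exact: domain_regular_weakly_uniserial.
  exact/domain_regular_weakly_uniserial/domain_converse.
(* Both alternatives make [R], and hence [R^c], a domain. *)
- apply/projective_weakly_uniserial/domain_converse.
  by case: hypR => [[]//|[]]; apply: hereditary_local_domain.
Qed.
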